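(* Let $K$ be a field, $A$ a finite-dimensional $K$-algebra, and $I\subset A$ an ideal generated by a set $X\subset Z(A)\cap\operatorname{rad}A$, where $Z(A)$ is the center and $\operatorname{rad}A$ the radical of $A$. Then the set of semibricks in $\operatorname{mod}A$ equals the set of semibricks in $\operatorname{mod}A/I$, where $\operatorname{mod}A/I$ is regarded as a full subcategory of $\operatorname{mod}A$.
   Context: $\operatorname{mod} A$ is the category of finite-dimensional right $A$-modules. A brick is a module $S$ with $\operatorname{End}_A(S)$ a division algebra. A semibrick is a (possibly infinite) set $\mathcal S$ of isoclasses of bricks with $\operatorname{Hom}_A(S_1,S_2)=0$ for all $S_1\neq S_2$ in $\mathcal S$. *)

(* Defs.v *)
From HB Require Import structures.
From mathcomp Require Import all_boot all_algebra.
From mathcomp Require Import boolp classical_sets.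

Set Implicit Arguments.
Unset Strict Implicit.
Unset Printing Implicit Defensive.

Import GRing.Theory.
Local Open Scope ring_scope.
Local Open Scope classical_set_scope.
Local Open Scope quotient_scope.

(* MathComp's algType requires 1 != 0, so it has neither the zero algebra nor
   A/I for arbitrary I.  Here a K-algebra is a ring with a ring morphism from K
   to its center; [kalgebra_of_algType] covers every algType. *)
Record kalgebra (K : fieldType) := KAlgebra {
  kalg_ring :> pzRingType;
  kalg_in : {rmorphism K -> kalg_ring};
  kalg_inC : forall (k : K) (a : kalg_ring), kalg_in k * a = a * kalg_in k
}.
Arguments kalg_in {K} A : rename.

Lemma in_algC (K : fieldType) (A : algType K) (k : K) (a : A) :
  in_alg A k * a = a * in_alg A k.
Proof. by rewrite /= mulr_algl mulr_algr. Qed.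

Definition kalgebra_of_algType (K : fieldType) (A : algType K) : kalgebra K :=
  KAlgebra (@in_algC K A).

Definition restrict (R S : pzRingType) (phi : {rmorphism R -> S})
  (M : lmodType S) : Type := M.

Section Restrict.
Variables (R S : pzRingType) (phi : {rmorphism R -> S}) (M : lmodType S).
Local Notation N := (restrict phi M).

HB.instance Definition _ := GRing.Zmodule.on N.

Definition restrict_scale (r : R) (v : N) : N := phi r *: (v : M).

Lemma restrict_scalerA a b v :
  restrict_scale a (restrict_scale b v) = restrict_scale (a * b) v.
Proof. by rewrite /restrict_scale scalerA -rmorphM. Qed.

Lemma restrict_scale1r : left_id 1 restrict_scale.
Proof. by move=> v; rewrite /restrict_scale rmorph1 scale1r. Qed.

Lemma restrict_scalerDr : right_distributive restrict_scale +%R.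
Proof. by move=> a u v; rewrite /restrict_scale scalerDr. Qed.

Lemma restrict_scalerDl v : {morph restrict_scale^~ v : a b / a + b}.
Proof. by move=> a b; rewrite /restrict_scale rmorphD scalerDl. Qed.

HB.instance Definition _ := GRing.Zmodule_isLmodule.Build R N
  restrict_scalerA restrict_scale1r restrict_scalerDr restrict_scalerDl.
End Restrict.

Definition finite_dimensional (K : fieldType) (V : lmodType K) : Prop :=
  exists (n : nat) (e : 'I_n -> V),
    forall v : V, exists c : 'I_n -> K, v = \sum_i c i *: e i.

Section Scalars.
Variables (K : fieldType) (A : kalgebra K).

Definition finite_dimensional_algebra : Prop :=
  finite_dimensional (restrict (kalg_in A) A^o).

Definition scalars (k : K) : A^c := kalg_in A k.

Lemma scalars_zmod : zmod_morphism scalars.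
Proof. by move=> k l; rewrite /scalars rmorphB. Qed.

Lemma scalars_monoid : monoid_morphism scalars.
Proof.
split=> [|k l]; first by rewrite /scalars rmorph1.
by rewrite /scalars rmorphM kalg_inC.
Qed.

HB.instance Definition _ := GRing.isZmodMorphism.Build K A^c scalars scalars_zmod.
HB.instance Definition _ :=
  GRing.isMonoidMorphism.Build K A^c scalars scalars_monoid.
End Scalars.

(* The objects of mod A.  A right A-module is a left module over the converse
   ring A^c, the vector [(a : A^c) *: v] standing for v.a; its K-vector space
   structure is that of [restrict (scalars A) M], in which k acts as k.1_A. *)
Record modcat (K : fieldType) (A : kalgebra K) := Modcat {
  modcat_sort :> lmodType A^c;
  modcat_fin : finite_dimensional (restrict (scalars A) modcat_sort)
}.

(* Sets of (sets of) modules.  The universe of [set] lies below that of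
   [lmodType], so they cannot be of type [set (modcat A)]. *)
Definition coll (T : Type) : Type := T -> Prop.

Definition coll_image (T U : Type) (f : T -> U) (P : coll T) : coll U :=
  fun y => exists2 x, P x & f x = y.

Section Semibricks.
Variables (K : fieldType) (A : kalgebra K).
Implicit Types M N : modcat A.

Definition isomorphic M N : Prop := exists f : {linear M -> N}, bijective f.

Definition isoclass M : coll (modcat A) := fun N => isomorphic M N.

(* The ring End_A(M), under composition, is a division ring: 1 <> 0 and every
   nonzero element has a two-sided inverse. *)
Definition brick M : Prop :=
  ~ (idfun =1 (fun=> 0) :> (M -> M)) /\
  forall f : {linear M -> M}, ~ (f =1 (fun=> 0)) ->
    exists g : {linear M -> M}, f \o g =1 idfun /\ g \o f =1 idfun.

Definition semibrick (S : coll (coll (modcat A))) : Prop :=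
  (forall C, S C -> exists2 M, brick M & C = isoclass M) /\
  (forall M N, S (isoclass M) -> S (isoclass N) -> isoclass M <> isoclass N ->
     forall f : {linear M -> N}, f =1 (fun=> 0)).

Definition semibricks : coll (coll (coll (modcat A))) := semibrick.
End Semibricks.
Arguments semibricks {K} A.

Section Ideals.
Variables (K : fieldType) (A : kalgebra K).
Implicit Types I J : set A.

Definition center : set A := [set z | forall a, z * a = a * z].

Definition is_right_ideal J : Prop :=
  [/\ J 0, (forall x y, J x -> J y -> J (x + y))
    & forall x a, J x -> J (x * a)].

Definition maximal_right_ideal J : Prop :=
  [/\ is_right_ideal J, J <> setT
    & forall J', is_right_ideal J' -> J `<=` J' -> J' = J \/ J' = setT].

(* The Jacobson radical; all of A when A = 0. *)
Definition radical : set A := \bigcap_(J in maximal_right_ideal) J.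

Definition is_ideal I : Prop :=
  is_right_ideal I /\ forall x a, I x -> I (a * x).

Record ideal := Ideal { ideal_set :> set A; idealP : is_ideal ideal_set }.
End Ideals.
Arguments center {K} A.
Arguments radical {K} A.
Arguments ideal {K} A.

Section Quotient.
Variables (K : fieldType) (A : kalgebra K) (I : ideal A).

Definition ideal_pred : {pred A} := fun x => `[< ideal_set I x >].

Lemma ideal_zmod_closed : zmod_closed ideal_pred.
Proof.
have [[I0 ID IM] _] := idealP I; split; first exact/asboolP.
move=> x y /asboolP Ix /asboolP Iy; apply/asboolP; apply: ID => //.
by rewrite -mulrN1; apply: IM.
Qed.

HB.instance Definition _ := GRing.isZmodClosed.Build A ideal_pred ideal_zmod_closed.

Definition quotient : Type := Quotient.quot (ideal_pred : zmodClosed A).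
HB.instance Definition _ := GRing.Zmodule.on quotient.
HB.instance Definition _ := EqQuotient.on quotient.

Definition proj (a : A) : quotient := \pi_quotient a.

Lemma proj_surj (q : quotient) : exists a, proj a = q.
Proof. by exists (repr q); rewrite /proj reprK. Qed.

Lemma proj_eq a b : proj a = proj b <-> ideal_set I (a - b).
Proof.
rewrite /proj; split=> [/eqP|Iab].
  by rewrite -[_ == _](@Quotient.idealrBE A ideal_pred) => /asboolP.
by apply/eqP; rewrite -[_ == _](@Quotient.idealrBE A ideal_pred); apply/asboolP.
Qed.

Lemma projB : {morph proj : a b / a - b}.
Proof. by move=> a b; rewrite /proj (raddfB (\pi_(Quotient.quot _))). Qed.

Lemma proj_repr q : proj (repr q) = q. Proof. by rewrite /proj reprK. Qed.

Definition qone : quotient := proj 1.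
Definition qmul (p q : quotient) : quotient := proj (repr p * repr q).

Lemma repr_proj a : ideal_set I (repr (proj a) - a).
Proof. by apply/proj_eq; rewrite proj_repr. Qed.

Lemma projD : {morph proj : a b / a + b}.
Proof. by move=> a b; rewrite /proj (raddfD (\pi_(Quotient.quot _))). Qed.

Lemma proj_qmul a b : proj (a * b) = qmul (proj a) (proj b).
Proof.
have [[I0 ID IMr] IMl] := idealP I.
apply/esym/proj_eq; set x := repr _; set y := repr _.
have -> : x * y - a * b = (x - a) * y + a * (y - b).
  by rewrite mulrBl mulrBr addrA subrK.
by apply: ID; [apply: IMr|apply: IMl]; apply: repr_proj.
Qed.

Lemma qmulA : associative qmul.
Proof.
move=> p q r; rewrite -(proj_repr p) -(proj_repr q) -(proj_repr r).
by rewrite -!proj_qmul mulrA.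
Qed.
Lemma qmul1 : left_id qone qmul.
Proof. by move=> p; rewrite -(proj_repr p) -proj_qmul mul1r. Qed.
Lemma qmulr1 : right_id qone qmul.
Proof. by move=> p; rewrite -(proj_repr p) -proj_qmul mulr1. Qed.
Lemma qmulDl : left_distributive qmul +%R.
Proof.
move=> p q r; rewrite -(proj_repr p) -(proj_repr q) -(proj_repr r).
by rewrite -projD -!proj_qmul mulrDl projD.
Qed.
Lemma qmulDr : right_distributive qmul +%R.
Proof.
move=> p q r; rewrite -(proj_repr p) -(proj_repr q) -(proj_repr r).
by rewrite -projD -!proj_qmul mulrDr projD.
Qed.

HB.instance Definition _ := GRing.Zmodule_isPzRing.Build quotient
  qmulA qmul1 qmulr1 qmulDl qmulDr.

Lemma projM : {morph proj : a b / a * b}. Proof. exact: proj_qmul. Qed.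

Definition quotient_in (k : K) : quotient := proj (kalg_in A k).

Lemma quotient_in_zmod : zmod_morphism quotient_in.
Proof. by move=> k l; rewrite /quotient_in rmorphB projB. Qed.

Lemma quotient_in_monoid : monoid_morphism quotient_in.
Proof.
split=> [|k l]; first by rewrite /quotient_in rmorph1.
by rewrite /quotient_in rmorphM projM.
Qed.

HB.instance Definition _ :=
  GRing.isZmodMorphism.Build K quotient quotient_in quotient_in_zmod.
HB.instance Definition _ :=
  GRing.isMonoidMorphism.Build K quotient quotient_in quotient_in_monoid.

Lemma quotient_inC k (q : quotient) : quotient_in k * q = q * quotient_in k.
Proof. by rewrite -(proj_repr q) -!projM kalg_inC. Qed.

Definition quotient_algebra : kalgebra K := KAlgebra quotient_inC.

(* The projection A -> A/I, as a morphism of the converse rings. *)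
Definition cproj (a : A^c) : quotient^c := proj a.

Lemma cproj_monoid : monoid_morphism cproj.
Proof. by split=> // a b; rewrite /cproj [LHS]projM. Qed.

HB.instance Definition _ := GRing.isZmodMorphism.Build A^c quotient^c cproj projB.
HB.instance Definition _ :=
  GRing.isMonoidMorphism.Build A^c quotient^c cproj cproj_monoid.

Section Inflate.
Variable N : modcat quotient_algebra.

Lemma inflate_fin :
  finite_dimensional (restrict (scalars A) (restrict cproj N)).
Proof.
have [n [e He]] := modcat_fin N; exists n, e => v.
have [c Hc] := He v; exists c; rewrite [LHS]Hc.
apply: eq_bigr => i _; rewrite /GRing.scale /= /restrict_scale.
by [].
Qed.

Definition inflate : modcat A := Modcat inflate_fin.
End Inflate.

(* The inclusion of mod A/I in mod A, on isoclasses: the class of N is sent to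
   the class of its restriction of scalars along A -> A/I. *)
Definition inflate_class (C : coll (modcat quotient_algebra)) : coll (modcat A) :=
  fun M => exists2 N, C N & isomorphic (inflate N) M.
End Quotient.

(* Main.v *)
(** A central element [x] of the radical is nilpotent, since [A] is
    finite-dimensional.  It acts on a brick by a nilpotent endomorphism, which
    cannot be invertible and hence is zero.  So [I] annihilates every brick, and
    every brick of [mod A] comes from [mod A/I]; the inclusion of [mod A/I]
    being fully faithful, it preserves and reflects the other conditions. *)
From HB Require Import structures.
Require Import Defs.
From mathcomp Require Import all_boot all_algebra.
From mathcomp Require Import boolp classical_sets.

Set Implicit Arguments.
Unset Strict Implicit.
Unset Printing Implicit Defensive.

Import GRing.Theory.
Local Open Scope ring_scope.
Local Open Scope classical_set_scope.

(** * Nilpotence of the elements of the radical *)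

Section Nilpotence.
Variables (K : fieldType) (A : kalgebra K).
Implicit Types (x a b : A) (J : set A).

Lemma right_ideal_mem1 J : is_right_ideal J -> J 1 -> J = setT.
Proof.
move=> [_ _ JM] J1; apply/predeqP => a; split=> // _.
by rewrite -[a]mul1r; apply: JM.
Qed.

(** Zorn's lemma, for the right ideals that contain [J] and avoid 1: these properties pass to the
    union of a nonempty chain. *)
Lemma sub_maximal_right_ideal J :
  is_right_ideal J -> ~ J 1 ->
  exists2 J', maximal_right_ideal J' & J `<=` J'.
Proof.
move=> idJ J1.
(* [Zorn_bigcup] also needs the union of the empty chain. *)
pose P (L : set A) := L = set0 \/ [/\ is_right_ideal L, ~ L 1 & J `<=` L].
have [F FP totF|L [PL maxL]] := @Zorn_bigcup A P.
  have [[L FL [y Ly]]|F0] := pselect (exists2 L, F L & L !=set0); last first.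
    left; apply/predeqP => y; split=> // -[L FL Ly].
    by apply: F0; exists L => //; exists y.
  have proper L' z : F L' -> L' z -> [/\ is_right_ideal L', ~ L' 1 & J `<=` L'].
    by move=> FL' L'z; have [L'0|//] := FP _ FL'; rewrite L'0 in L'z.
  right; split=> [|[L' FL' L'1]|z Jz].
  - split.
    + by exists L => //; have [[]] := proper _ _ FL Ly.
    + move=> u v [L1 FL1 L1u] [L2 FL2 L2v].
      have [[_ L1D _] _ _] := proper _ _ FL1 L1u.
      have [[_ L2D _] _ _] := proper _ _ FL2 L2v.
      have [L12|L21] := totF _ _ FL1 FL2.
        by exists L2 => //; apply: L2D => //; apply: L12.
      by exists L1 => //; apply: L1D => //; apply: L21.
    + move=> u a [L1 FL1 L1u]; exists L1 => //.
      by have [[_ _ L1M] _ _] := proper _ _ FL1 L1u; apply: L1M.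
  - by have [_ ] := proper _ _ FL' L'1.
  - by exists L => //; have [_ _ ] := proper _ _ FL Ly; apply.
have [idL L1 JL] : [/\ is_right_ideal L, ~ L 1 & J `<=` L].
  (* Were [L] empty, [J] would be strictly larger, since it contains 0. *)
  case: PL => // L0; exfalso; apply: (maxL J); last by right; split.
  have [J0 _ _] := idJ.
  rewrite L0; split=> [z //|]; by move=> /(_ 0 J0).
exists L => //; split=> // [LT|L' idL' LL']; first by apply: L1; rewrite LT.
have [L'1|L'1] := pselect (L' 1); first by right; apply: right_ideal_mem1.
left; apply: contrapT => L'L; apply: (maxL L'); last first.
  by right; split=> // z /JL /LL'.
split=> // L'L2; apply: L'L; apply/predeqP => z; split; [exact: L'L2|exact: LL'].
Qed.

(** Otherwise the right ideal generated by [1 + x * b] would lie in a maximal one; that one also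
    contains [x], hence 1. *)
Lemma radical_right_inv x b : radical A x -> exists a, (1 + x * b) * a = 1.
Proof.
move=> radx; pose J : set A := [set z | exists a, (1 + x * b) * a = z].
have idJ : is_right_ideal J.
  split; first by exists 0; rewrite mulr0.
    by move=> _ _ [u <-] [v <-]; exists (u + v); rewrite mulrDr.
  by move=> _ a [u <-]; exists (u * a); rewrite mulrA.
have [//|J1] := pselect (J 1).
have [J' maxJ' JJ'] := sub_maximal_right_ideal idJ J1.
have [idJ' J'T _] := maxJ'; have [_ J'D J'M] := idJ'.
exfalso; apply: J'T; apply: right_ideal_mem1 => //.
have J'x : J' x by apply: radx.
rewrite -[1](addrK (x * b)) -mulrN; apply: J'D; last exact: J'M.
by apply: JJ'; exists 1; rewrite mulr1.
Qed.

(** Take out the lowest power of [x] with a nonzero coefficient; [k] is that coefficient. *)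
Lemma sum_powers_factor x n (u : nat -> K) (j : nat) : (j < n)%N -> u j != 0 ->
  exists m k b, k != 0 /\
    \sum_(i < n) kalg_in A (u i) * x ^+ i = x ^+ m * (kalg_in A k + x * b).
Proof.
elim: n u j => // n IH u j ltjn uj0; rewrite big_ord_recl expr0 mulr1 /=.
under eq_bigr => i _ do rewrite /bump /= add1n exprS mulrA kalg_inC -mulrA.
rewrite -mulr_sumr.
(* If [u 0] is nonzero, then [m = 0] and [b] is the remaining sum; otherwise the induction
   hypothesis applies to the shifted sequence. *)
have [u0|u0] := eqVneq (u 0%N) 0; last first.
  exists 0%N, (u 0%N); eexists; split; first exact: u0.
  by rewrite expr0 mul1r.
case: j ltjn uj0 => [|j] ltjn uj0; first by rewrite u0 eqxx in uj0.
have [m [k [b [k0 ->]]]] := IH (fun i => u i.+1) j ltjn uj0.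
by exists m.+1, k, b; split=> //; rewrite u0 rmorph0 add0r exprS mulrA.
Qed.

(** If [n] elements span [A], the coordinates of the first [n.+1] powers form a matrix with more
    rows than columns, so some nonzero row vector kills it from the left. *)
Lemma powers_dependent x : finite_dimensional_algebra A ->
  exists n (u : nat -> K) j, [/\ (j < n)%N, u j != 0 &
    \sum_(i < n) kalg_in A (u i) * x ^+ i = 0].
Proof.
move=> [n [e He]].
have /boolp.choice [c Hc] : forall j : 'I_n.+1, exists c : 'I_n -> K,
    x ^+ j = \sum_i kalg_in A (c i) * (e i : A) by move=> j; apply: He.
pose C : 'M[K]_(n.+1, n) := \matrix_(j, i) c j i.
have : kermx C != 0.
  by rewrite -mxrank_eq0 mxrank_ker -lt0n subn_gt0 ltnS rank_leq_col.
case/rowV0Pn => v /sub_kermxP vC /rV0Pn [j vj].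
(* [inord] extends [v] to all natural numbers; only its values at indices up to [n] enter the
   sum. *)
exists n.+1, (fun i => v 0 (inord i)), j; split=> //; first by rewrite inord_val.
under eq_bigr => i _ do rewrite inord_val Hc mulr_sumr.
rewrite exchange_big big1 // => i _.
under eq_bigr => j' _ do rewrite mulrA -rmorphM.
rewrite -mulr_suml -rmorph_sum.
have -> : \sum_j' v 0 j' * c j' i = (v *m C) 0 i.
  by rewrite mxE; apply: eq_bigr => j' _; rewrite mxE.
by rewrite vC mxE rmorph0 mul0r.
Qed.

(** A linear relation between powers of [x] reads [x ^+ m * (k + x * b) = 0] with [k] nonzero, and
    the second factor has a right inverse because [x] is in the radical. *)
Lemma radical_nilpotent x : finite_dimensional_algebra A -> radical A x ->
  exists m, x ^+ m = 0.
Proof.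
move=> fdA radx; have [n [u [j [ltjn uj]]]] := powers_dependent x fdA.
have [m [k [b [k0 ->]]]] := sum_powers_factor x ltjn uj => xm0.
have [a Ha] := radical_right_inv (b * kalg_in A k^-1) radx.
exists m; rewrite -[x ^+ m]mulr1 -Ha.
have -> : 1 + x * (b * kalg_in A k^-1) = (kalg_in A k + x * b) * kalg_in A k^-1.
  by rewrite mulrDl -rmorphM divff // rmorph1 mulrA.
by rewrite !mulrA xm0 !mul0r.
Qed.
End Nilpotence.

(** * Construction of linear maps from functions *)

Section LinearMaps.
Variables (R : pzRingType).
Implicit Types U V W : lmodType R.

(** The equality of underlying functions lets one function be moved between module structures on the
    same set. *)
Lemma linear_exists {U V} (f : U -> V) : linear f ->
  exists g : {linear U -> V}, g = f :> (U -> V).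
Proof.
move=> lf; pose mf := GRing.isLinear.Build R U V *:%R f lf.
pose g : {linear U -> V} := HB.pack f mf.
by exists g.
Qed.

Lemma linear_inverse {U V} (f : {linear U -> V}) : bijective f ->
  exists g : {linear V -> U}, cancel f g /\ cancel g f.
Proof.
case=> g fK gK.
have [|g' g'E] := @linear_exists V U g; last by exists g'; rewrite g'E.
by move=> a u v; rewrite -{1}(gK u) -{1}(gK v) -linearP fK.
Qed.
End LinearMaps.

(** * Isomorphism classes, bricks and annihilators *)

Section Isomorphism.
Variables (K : fieldType) (A : kalgebra K).
Implicit Types M N L : modcat A.

Lemma isomorphicP M N : isomorphic M N ->
  exists (f : {linear M -> N}) (g : {linear N -> M}), cancel f g /\ cancel g f.
Proof. by move=> [f /linear_inverse [g fg]]; exists f, g. Qed.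

Lemma isomorphic_refl M : isomorphic M M.
Proof. by exists idfun; exists idfun. Qed.

Lemma isomorphic_sym M N : isomorphic M N -> isomorphic N M.
Proof. by move=> /isomorphicP [f [g [fK gK]]]; exists g; exists f. Qed.

Lemma isomorphic_trans M N L :
  isomorphic M N -> isomorphic N L -> isomorphic M L.
Proof. by move=> [f bf] [g bg]; exists (g \o f); apply: bij_comp. Qed.

Lemma isoclass_eq M N : isoclass M = isoclass N <-> isomorphic M N.
Proof.
split=> [MN|MN].
  by rewrite -[isomorphic M N]/(isoclass M N) MN; apply: isomorphic_refl.
apply: funext => L; apply: propext; split; apply: isomorphic_trans => //.
exact: isomorphic_sym.
Qed.

Lemma brick_iso M N : isomorphic M N -> brick M -> brick N.
Proof.
move=> /isomorphicP [f [g [fK gK]]] [M0 Minv]; split=> [N0|h h0].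
  by apply: M0 => u; rewrite -[LHS]fK -(linear0 g); congr (g _); apply: N0.
(* The inverse of [h] is found by conjugating [h] to an endomorphism of [M], inverting there and
   conjugating back. *)
have [|k [hk kh]] := Minv (g \o h \o f).
  move=> ghf; apply: h0 => v.
  by rewrite -[h v]gK -[v in h v]gK [g _]ghf linear0.
exists (f \o k \o g); split=> v /=.
  by rewrite -[LHS]gK; have /= -> := hk (g v); rewrite gK.
by have /= := kh (g v); rewrite gK => ->; rewrite gK.
Qed.

Lemma brick_nilpotent_eq0 M (f : {linear M -> M}) m :
  brick M -> (forall v, iter m f v = 0) -> f =1 (fun=> 0).
Proof.
move=> [M0 Minv] fm0; apply: contrapT => /Minv [g [_ gf]].
(* As [g] is a left inverse of [f], the vanishing of one iterate of [f] implies that of the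
   preceding one, down to the identity. *)
apply: M0 => v /=; elim: m fm0 => [|m IH] fm0; first exact: (fm0 v).
apply: IH => w; rewrite -[LHS]gf /=.
by have /= -> := fm0 w; rewrite linear0.
Qed.

Definition annihilator M : set A := [set a | forall v : M, (a : A^c) *: v = 0].

Lemma annihilator_ideal M : is_ideal (annihilator M).
Proof.
split; first split.
- by move=> v; apply: scale0r.
- by move=> a b Ma Mb v; rewrite [LHS]scalerDl Ma Mb addr0.
- move=> a b Ma v.
  by rewrite -[LHS](scalerA (b : A^c) (a : A^c)) Ma scaler0.
- move=> a b Ma v.
  by rewrite -[LHS](scalerA (a : A^c) (b : A^c)) Ma.
Qed.

(** Centrality of [x] makes its action on [M] an endomorphism, and nilpotence of [x] makes that
    endomorphism nilpotent. *)
Lemma center_radical_brick M x : finite_dimensional_algebra A ->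
  center A x -> radical A x -> brick M -> annihilator M x.
Proof.
move=> fdA cx rx bM.
have [|f fE] := @linear_exists A^c M M (fun v => (x : A^c) *: v).
  move=> a u v; rewrite scalerDr !scalerA; congr (_ *: u + _).
  exact: esym (cx a).
have [m xm] := radical_nilpotent fdA rx.
have fm v : iter m f v = 0.
  have -> : iter m f v = ((x ^+ m : A) : A^c) *: v.
    elim: (m) => [|k IH] /=; first by rewrite expr0 [RHS]scale1r.
    by rewrite IH fE scalerA exprSr.
  by rewrite xm [LHS]scale0r.
by move=> v; have := brick_nilpotent_eq0 bM fm v; rewrite fE.
Qed.
End Isomorphism.

(** * Full faithfulness of the inclusion of mod A/I in mod A *)

Section Inflation.
Variables (K : fieldType) (A : kalgebra K) (I : ideal A).
Local Notation B := (quotient_algebra I).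
Implicit Types M : modcat A.
Implicit Types N : modcat B.

Lemma inflate_hom N N' (f : {linear N -> N'}) :
  exists g : {linear inflate N -> inflate N'}, g = f :> (N -> N').
Proof.
apply: (@linear_exists A^c (inflate N) (inflate N') f) => a u v.
exact: (linearP f (cproj I a) u v).
Qed.

(** Every scalar of A/I is the image of some [a] in [A], and acts on [N] as [a] acts on
    [inflate N]. *)
Lemma inflate_full N N' (f : {linear inflate N -> inflate N'}) :
  exists g : {linear N -> N'}, g = f :> (N -> N').
Proof.
apply: (@linear_exists _ N N' f) => q u v.
have [a <-] := proj_surj q.
exact: (linearP f a u v).
Qed.

Lemma inflate_iso N N' :
  isomorphic (inflate N) (inflate N') <-> isomorphic N N'.
Proof.
split=> -[f bf].
  by have [g gE] := inflate_full f; exists g; rewrite gE.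
by have [g gE] := inflate_hom f; exists g; rewrite gE.
Qed.

(** [N] and [inflate N] have the same underlying set and the same endomorphisms, hence the same
    invertible ones. *)
Lemma inflate_brick N : brick (inflate N) <-> brick N.
Proof.
split=> -[N0 Ninv]; split=> // f f0.
  have [g gE] := inflate_hom f.
  have [|h] := Ninv g; first by rewrite gE.
  rewrite gE => -[fh hf].
  by have [k kE] := inflate_full h; exists k; rewrite kE.
have [g gE] := inflate_full f.
have [|h] := Ninv g; first by rewrite gE.
rewrite gE => -[fh hf].
by have [k kE] := inflate_hom h; exists k; rewrite kE.
Qed.

Lemma inflate_isoclass N :
  @inflate_class K A I (isoclass N) = isoclass (inflate N).
Proof.
apply: funext => M; apply: propext; split=> [[N' NN'] N'M|NM].
  by apply: isomorphic_trans N'M; apply/inflate_iso.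
by exists N => //; apply: isomorphic_refl.
Qed.

(** * Modules annihilated by I, as modules over A/I *)

Section Deflate.
Variables (M : modcat A) (IM : ideal_set I `<=` annihilator M).

(** A copy of [M] indexed by the proof that [I] annihilates [M], so that the A/I-module structure
    attached to the type can refer to this proof. *)
Definition deflated of (ideal_set I `<=` annihilator M) : Type := M.
Local Notation D := (deflated IM).

HB.instance Definition _ := GRing.Zmodule.on D.

Definition deflate_scale (q : (quotient I)^c) (v : D) : D :=
  (repr (q : quotient I) : A^c) *: (v : M).

(** The chosen representative of the class of [a] differs from [a] by an element of [I], which kills
    [M]; so the action is independent of the choice. *)
Lemma deflate_scale_proj (a : A) v :
  deflate_scale (proj I a) v = (a : A^c) *: (v : M).
Proof.
apply/eqP; rewrite -subr_eq0 -[X in X == _](@scalerBl A^c M); apply/eqP.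
exact: (IM (repr_proj I a)).
Qed.

Lemma deflate_scalerA p q v :
  deflate_scale p (deflate_scale q v) = deflate_scale (p * q) v.
Proof.
have [a <-] := proj_surj p; have [b <-] := proj_surj q.
rewrite -[_ * _ in RHS](projM I b a) !deflate_scale_proj.
exact: (scalerA (a : A^c) (b : A^c)).
Qed.

Lemma deflate_scale1r : left_id 1 deflate_scale.
Proof. by move=> v; rewrite [LHS](deflate_scale_proj 1) [LHS]scale1r. Qed.

Lemma deflate_scalerDr : right_distributive deflate_scale +%R.
Proof. by move=> q u v; rewrite /deflate_scale scalerDr. Qed.

Lemma deflate_scalerDl v : {morph deflate_scale^~ v : p q / p + q}.
Proof.
move=> p q; have [a <-] := proj_surj p; have [b <-] := proj_surj q.
rewrite -[_ + _ in LHS](projD I a b) !deflate_scale_proj.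
exact: (scalerDl (v : M) (a : A^c) (b : A^c)).
Qed.

HB.instance Definition _ := GRing.Zmodule_isLmodule.Build (quotient I)^c D
  deflate_scalerA deflate_scale1r deflate_scalerDr deflate_scalerDl.

Lemma deflate_fin :
  finite_dimensional (restrict (scalars (quotient_algebra I)) D).
Proof.
have [n [e He]] := modcat_fin M; exists n, e => v.
have [c Hc] := He v; exists c; rewrite [LHS]Hc.
by apply: eq_bigr => i _; rewrite [RHS]deflate_scale_proj.
Qed.

Definition deflate : modcat B := @Modcat K B D deflate_fin.

Lemma inflate_deflate : isomorphic (inflate deflate) M.
Proof.
have [|f fE] := @linear_exists A^c (inflate deflate) M id.
  by move=> a u v; congr (_ + _); apply: deflate_scale_proj.
by exists f; rewrite fE; exists id.
Qed.
End Deflate.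
End Inflation.

(** * Comparison of the semibricks over A and over A/I *)

Theorem proposition1p29 (K : fieldType) (A : kalgebra K)
    (fdA : finite_dimensional_algebra A) (X : set A)
    (X_sub : X `<=` center A `&` radical A)
    (I : ideal A) (I_gen : ideal_set I = smallest (@is_ideal K A) X) :
  semibricks A =
  coll_image (coll_image (@inflate_class K A I))
    (semibricks (quotient_algebra I)).
Proof.
(* The annihilator is an ideal containing [X], hence contains the smallest such ideal. *)
have I_ann M : brick M -> ideal_set I `<=` annihilator M.
  move=> bM a; rewrite I_gen; apply; split; first exact: annihilator_ideal.
  by move=> x /X_sub [cx rx]; apply: center_radical_brick.
apply: funext => S; apply: propext; split=> [[Sbrick Shom]|[T [Tbrick Thom] <-]].
  (* The preimage of [S]: the classes over A/I whose inflation belongs to [S]. *)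
  exists (fun C => exists2 N, C = isoclass N & S (isoclass (inflate N))).
    split=> [C [N -> SN]|N N' [N1 + SN1] [N1' + SN1'] NN' f].
      exists N => //; have [M bM /isoclass_eq NM] := Sbrick _ SN.
      by apply/inflate_brick; apply: brick_iso bM; apply: isomorphic_sym.
    (* [N1] and [N1'] are other representatives of the classes of [N] and [N']; inflating the
       isomorphisms shows that the classes of [inflate N] and [inflate N'] lie in [S]. *)
    move=> /isoclass_eq /inflate_iso /isoclass_eq E.
    move=> /isoclass_eq /inflate_iso /isoclass_eq E'.
    rewrite -{}E in SN1; rewrite -{}E' in SN1'.
    have [g gE] := inflate_hom f; rewrite -gE.
    apply: (Shom _ _ SN1 SN1' _ g).
    by move=> /isoclass_eq /inflate_iso /isoclass_eq.
  apply: funext => C; apply: propext; split=> [[_ [N -> SN] <-]|SC].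
    by rewrite inflate_isoclass.
  (* Each class in [S] is reached: its brick [M] is annihilated by [I], so it is the inflation of
     its deflation up to isomorphism. *)
  have [M bM CM] := Sbrick _ SC.
  have /isoclass_eq DM := inflate_deflate (I_ann _ bM).
  exists (isoclass (deflate (I_ann _ bM))); last first.
    by rewrite inflate_isoclass DM CM.
  by exists (deflate (I_ann _ bM)); rewrite // DM -CM.
split=> [_ [C TC <-]|M M' [C TC CM] [C' TC' CM'] MM' f].
  have [N bN ->] := Tbrick _ TC; rewrite inflate_isoclass.
  by exists (inflate N) => //; apply/inflate_brick.
have [N bN CN] := Tbrick _ TC; have [N' bN' CN'] := Tbrick _ TC'.
rewrite {}CN in TC CM; rewrite {}CN' in TC' CM'.
rewrite inflate_isoclass in CM; rewrite inflate_isoclass in CM'.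
have /isoclass_eq/isomorphicP [g [g' [gK g'K]]] := CM.
have /isoclass_eq/isomorphicP [h [h' [hK h'K]]] := CM'.
(* [M] and [M'] are only isomorphic to inflations, so [f] is transported along [g] and [h'] before
   it descends to a map from [N] to [N']. *)
have [k kE] := inflate_full (h' \o f \o g).
have k0 : k =1 (fun=> 0).
  by apply: Thom => // E; apply: MM'; rewrite -CM -CM' -!inflate_isoclass E.
move=> v; rewrite -[v]g'K -[LHS]h'K.
have := k0 (g' v); rewrite kE /= => ->; exact: linear0.
Qed.
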